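(* Let $R$ be a ring and let $a \in R$ be an element such that $a^n$ is regular for every positive integer $n$. Put $K = \mathrm{r}_R(a) = \{x \in R : ax = 0\}$. Then for every positive integer $n$ there exist right ideals $X_n, Y_n, E_n$ of $R$ giving (internal) direct sum decompositions $$R_R = K \oplus X_n \oplus Y_n = E_n \oplus X_n \oplus aY_n,$$ where $Y_n \subseteq a^nR$, $K \oplus Y_n = K + a^nR$, and $E_n \cong R/aR$ as right $R$-modules. If $a^n = 0$ for some positive integer $n$, then for this $n$ one has $K \cong E_n \cong R/aR$ as right $R$-modules, and $a$ is unit-regular.
   Context: Rings are associative with identity, not necessarily commutative; $R_R$ denotes $R$ as a right module over itself. An element $b \in R$ is regular (in the sense of von Neumann) if $b = bxb$ for some $x \in R$, and unit-regular if $b = bub$ for some unit $u \in R$. For a right ideal $Y$, $aY = \{ay : y \in Y\}$. *)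

(* Defs.v *)
From HB Require Import structures.
From mathcomp Require Import all_boot all_algebra.
From mathcomp Require Import boolp.

Set Implicit Arguments.
Unset Strict Implicit.
Unset Printing Implicit Defensive.

Import GRing.Theory.
Local Open Scope ring_scope.
Local Open Scope quotient_scope.

(* Submodules are boolean predicates; boolp's classical logic makes this no
   restriction on which subsets of a module can occur.
   Rings are pzRingType: possibly noncommutative, possibly the zero ring. *)

Section Modules.
Variables (S : pzRingType) (V : lmodType S).
Implicit Types (U : submodClosed V) (A B C : {pred V}).

Definition submod_zmodClosed U : zmodClosed V :=
  HB.pack_for (zmodClosed V) (GRing.SubmodClosed.sort U)
    (GRing.isZmodClosed.Build V (GRing.SubmodClosed.sort U)
       (GRing.subsemimod_closedB (GRing.subsemimodClosedP U))).

Definition submod U : Type := {x : V | x \in U}.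
HB.instance Definition _ U := SubChoice.on (submod U).
HB.instance Definition _ U :=
  [SubChoice_isSubLmodule of submod U by <:].

Section Quotient.
Variable U : submodClosed V.

Definition quotmod : Type := Quotient.quot (submod_zmodClosed U).
HB.instance Definition _ := GRing.Zmodule.on quotmod.
HB.instance Definition _ := EqQuotient.on quotmod.

Definition quot_scale (s : S) (q : quotmod) : quotmod :=
  \pi_quotmod (s *: repr q).

Lemma quot_scaleE s x : quot_scale s (\pi_quotmod x) = \pi_quotmod (s *: x).
Proof.
apply/eqP; rewrite -(@Quotient.idealrBE V (submod_zmodClosed U)) -scalerBr.
by apply: rpredZ; rewrite (@Quotient.idealrBE V (submod_zmodClosed U)) reprK.
Qed.

Lemma quot_piD (x y : V) :
  \pi_quotmod (x + y) = \pi_quotmod x + \pi_quotmod y.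
Proof. exact: (@Quotient.pi_add V (submod_zmodClosed U) x y). Qed.

Lemma quot_scaleA s t q : quot_scale s (quot_scale t q) = quot_scale (s * t) q.
Proof. by elim/quotW: q => x; rewrite (quot_scaleE t) !quot_scaleE scalerA. Qed.

Lemma quot_scale1 : left_id 1 quot_scale.
Proof. by elim/quotW=> x; rewrite quot_scaleE scale1r. Qed.

Lemma quot_scaleDr : right_distributive quot_scale +%R.
Proof.
move=> s; elim/quotW=> x; elim/quotW=> y.
by rewrite -quot_piD !quot_scaleE scalerDr quot_piD.
Qed.

Lemma quot_scaleDl q : {morph quot_scale^~ q : s t / s + t}.
Proof.
by move=> s t; elim/quotW: q => x; rewrite !quot_scaleE scalerDl quot_piD.
Qed.

HB.instance Definition _ := GRing.Zmodule_isLmodule.Build S quotmod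
  quot_scaleA quot_scale1 quot_scaleDr quot_scaleDl.
End Quotient.

Definition sum2 A B : {pred V} :=
  [pred x | `[< exists u v, [/\ u \in A, v \in B & x = u + v] >]].

(* Independence, stated for submodules; is_dsum2 W A B and is_dsum3 W A B C say
   that W is the internal direct sum of A, B (and C). *)
Definition direct2 A B : Prop :=
  forall u v, u \in A -> v \in B -> u + v = 0 -> u = 0 /\ v = 0.

Definition direct3 A B C : Prop :=
  forall u v w, u \in A -> v \in B -> w \in C -> u + v + w = 0 ->
    [/\ u = 0, v = 0 & w = 0].

Definition is_dsum2 (W A B : {pred V}) : Prop :=
  direct2 A B /\ W =i sum2 A B.

Definition is_dsum3 (W A B C : {pred V}) : Prop :=
  direct3 A B C /\ W =i sum2 (sum2 A B) C.

End Modules.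

Definition isomorphic (S : pzRingType) (M N : lmodType S) : Prop :=
  exists f : {linear M -> N}, bijective f.

(* R as a right module over itself: right R-modules are left modules over the
   converse ring R^c, and R^c acts on (R^c)^o by right multiplication in R. *)
Definition right_regular (R : pzRingType) := (R^c)^o.
HB.instance Definition _ (R : pzRingType) := GRing.Lmodule.on (right_regular R).

Lemma right_regular_scaleE (R : pzRingType) (r : R^c) (x : right_regular R) :
  r *: x = (x : R) * (r : R).
Proof. by []. Qed.

Notation right_ideal R := (submodClosed (right_regular R)).

Section RightIdeals.
Variables (R : pzRingType) (a : R).

Definition rann_pred : {pred right_regular R} :=
  [pred x : right_regular R | a * (x : R) == 0].

Lemma rann_submod_closed : submod_closed rann_pred.
Proof.
split=> [|r x y]; rewrite !inE ?mulr0 // => /eqP ax0 /eqP ay0.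
by rewrite mulrDr right_regular_scaleE mulrA ax0 mul0r add0r ay0.
Qed.
HB.instance Definition _ :=
  GRing.isSubmodClosed.Build R^c (right_regular R) rann_pred rann_submod_closed.

Definition rann : right_ideal R := rann_pred.

Definition lmul_image (Y : {pred right_regular R}) : {pred right_regular R} :=
  [pred x : right_regular R | `[< exists2 y : R, y \in Y & (x : R) = a * y >]].

Definition principal_pred : {pred right_regular R} :=
  [pred x : right_regular R | `[< exists r : R, (x : R) = a * r >]].

Lemma principal_submod_closed : submod_closed principal_pred.
Proof.
split=> [|r x y]; rewrite !inE.
  by apply/asboolP; exists 0; rewrite mulr0.
move=> /asboolP[s xE] /asboolP[t yE]; apply/asboolP.
by exists (s * r + t); rewrite mulrDr mulrA -xE -yE.
Qed.
HB.instance Definition _ :=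
  GRing.isSubmodClosed.Build R^c (right_regular R) principal_pred
    principal_submod_closed.

Definition principal : right_ideal R := principal_pred.

End RightIdeals.

Definition vn_regular (R : pzRingType) (b : R) : Prop :=
  exists x : R, b = b * x * b.

(* MathComp's GRing.unit excludes the zero ring. *)
Definition invertible (R : pzRingType) (u : R) : Prop :=
  exists v : R, u * v = 1 /\ v * u = 1.

Definition unit_regular (R : pzRingType) (b : R) : Prop :=
  exists2 u : R, invertible u & b = b * u * b.

(* Main.v *)
(** Let [W_n] be the right ideal of all [w] with [a w] in [a^{n+1}R], that is
    [K + a^n R].  As [a] and [a^{n+1}] are regular, [W_n] is a direct summand of
    [R], and [X_n] may be any complement of it.  The point is that every
    complement [E_n] of [a^{n+1}R] in [W_n] is isomorphic to [R/aR]: both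
    [W_n / a^{n+1}R] and [W_{n+1} / a^{n+2}R] are split extensions of
    [W_{n+1} / a^{n+1}R] and [W_n / W_{n+1}], the latter being carried by [a]
    isomorphically onto [a^{n+1}R / a^{n+2}R].  The isomorphisms are realised
    as left multiplications by elements [p] of [R] with right annihilator [aR],
    so that [pR] is isomorphic to [R/aR]. *)
From HB Require Import structures.
Require Import Defs.
From mathcomp Require Import all_boot all_algebra.
From mathcomp Require Import boolp.
Import GRing.Theory.
Local Open Scope ring_scope.
Local Open Scope quotient_scope.

(** * Isomorphisms between submodules, principal right ideals and quotients *)

Lemma isomorphic_submod_eqi (S : pzRingType) (V : lmodType S)
    (A B : submodClosed V) : A =i B -> isomorphic (submod A) (submod B).
Proof.
move=> AB.
have ABP (x : submod A) : val x \in B by rewrite -AB (valP x).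
have BAP (x : submod B) : val x \in A by rewrite AB (valP x).
pose f (x : submod A) : submod B := Sub (val x) (ABP x).
have f_lin : linear f.
  by move=> s x y; apply: val_inj; rewrite /f SubK !linearP.
pose fM := GRing.isLinear.Build S (submod A) (submod B) _ f f_lin.
pose F : {linear submod A -> submod B} := HB.pack f fM.
exists F; exists (fun x => Sub (val x) (BAP x)) => x; apply: val_inj;
  by rewrite !SubK.
Qed.

Lemma principalP (R : pzRingType) (b x : R) :
  reflect (exists r, x = b * r) (x \in principal b).
Proof. exact: asboolP. Qed.

(** First isomorphism theorem for left multiplication by [p], whose kernel is [U]. *)
Lemma isomorphic_principal_quotmod (R : pzRingType) (p : R)
    (U : right_ideal R) :
    (forall r : R, p * r = 0 <-> r \in U) ->
  isomorphic (submod (principal p)) (quotmod U).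
Proof.
move=> pU.
have piE (r s : R) : p * r = p * s -> \pi_(quotmod U) r = \pi_(quotmod U) s.
  move=> prs; apply/eqP; rewrite -(@Quotient.idealrBE _ (submod_zmodClosed U)).
  by apply/pU; rewrite mulrBr prs subrr.
have pX (x : submod (principal p)) : exists r : R, (val x : R) = p * r.
  exact/principalP/(valP x).
(* The cofactor [c x] is chosen classically; by [piE] its class does not depend on the choice. *)
pose c x : R := sval (cid (pX x)).
have cE x : (val x : R) = p * c x := svalP (cid (pX x)).
pose f (x : submod (principal p)) : quotmod U := \pi_(quotmod U) (c x).
have f_lin : linear f.
  move=> s x y; rewrite /f.
  rewrite (quot_scaleE U s (c x) : s *: \pi_(quotmod U) (c x) = _) -quot_piD.
  apply: piE.
  rewrite -cE mulrDr -cE right_regular_scaleE mulrA -cE.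
  exact: (linearP (\val : submod (principal p) -> right_regular R) s x y).
pose fM := GRing.isLinear.Build _ (submod (principal p)) (quotmod U) _ f f_lin.
pose F : {linear submod (principal p) -> quotmod U} := HB.pack f fM.
have pP (r : R) : p * r \in principal p by apply/principalP; exists r.
exists F; exists (fun q : quotmod U => Sub (p * (repr q : R)) (pP (repr q))).
  move=> x; apply: val_inj; rewrite SubK [RHS]cE.
  apply/eqP; rewrite -subr_eq0 -mulrBr; apply/eqP/pU.
  by rewrite (@Quotient.idealrBE _ (submod_zmodClosed U)) reprK.
move=> q; rewrite -[RHS]reprK; apply: piE; rewrite -cE; exact: SubK.
Qed.

(** * Projections attached to the powers of [a] *)

Section PowersRegular.
Variables (R : pzRingType) (a : R) (y : nat -> R).
Hypothesis yP : forall n, a ^+ n * (y n * a ^+ n) = a ^+ n.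

Let e n : R := a ^+ n * y n.

(** [e m] is an idempotent with image [a^m R], which contains [a^n R]. *)
Lemma pow_proj m n z : (m <= n)%N -> e m * (a ^+ n * z) = a ^+ n * z.
Proof.
by move=> /subnKC <-; rewrite exprD /e -!mulrA (mulrA (y m)) mulrA yP.
Qed.

Lemma proj_proj m n z : (m <= n)%N -> e m * (e n * z) = e n * z.
Proof. by move=> mn; rewrite /e -(mulrA (a ^+ n)) pow_proj. Qed.

Lemma mul_inner1 z : a * (y 1 * z) = e 1 * z.
Proof. by rewrite /e expr1 mulrA. Qed.

Lemma proj1_mul z : e 1 * (a * z) = a * z.
Proof. by have := pow_proj 1 1 z (leqnn 1); rewrite expr1. Qed.

(* [f n] is a projection onto [W n]; [T n] maps [W n] to [W n.+1] with kernel
   [a^{n+1}R], being [1 - e n.+1] on [W n.+1] and [a] on the complement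
   [d n.+1 (W n)]. *)
Let d n z : R := y 1 * (a * z - e n.+1 * (a * z)).
Let f n z : R := z - d n z.
Let T n : R := (1 - e n.+1) * (1 - y 1 * (1 - e n.+2) * a) + (1 - e n.+2) * a.

(** Membership of [a * w] in [a^{n+1}R], encoded as a fixed-point equation for the idempotent
    [e n.+1]. *)
Let W n w := e n.+1 * (a * w) = a * w.

Lemma mul_d n z : a * d n z = a * z - e n.+1 * (a * z).
Proof. by rewrite mul_inner1 mulrBr proj1_mul proj_proj. Qed.

Lemma mul_f n z : a * f n z = e n.+1 * (a * z).
Proof. by rewrite mulrBr mul_d opprB addrC subrK. Qed.

Lemma W_f n z : W n (f n z).
Proof. by rewrite /W mul_f proj_proj. Qed.

Lemma d_W n w : W n w -> d n w = 0.
Proof. by rewrite /d => ->; rewrite subrr mulr0. Qed.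

Lemma f_W n w : W n w -> f n w = w.
Proof. by rewrite /f => /d_W ->; rewrite subr0. Qed.

Lemma W_add n u v : W n u -> W n v -> W n (u + v).
Proof. by rewrite /W !mulrDr => -> ->. Qed.

Lemma W_opp n u : W n u -> W n (- u).
Proof. by rewrite /W !mulrN => ->. Qed.

Lemma W_pow m n z : (n <= m)%N -> W n (a ^+ m * z).
Proof. by move=> nm; rewrite /W (mulrA a) -exprS pow_proj. Qed.

Lemma W_rann n z : a * z = 0 -> W n z.
Proof. by rewrite /W => ->; rewrite mulr0. Qed.

Lemma TE n w :
  T n * w = f n.+1 w - e n.+1 * f n.+1 w + (a * w - e n.+2 * (a * w)).
Proof.
rewrite /f /d /T mulrDl -!mulrA !(mulrBl, mul1r) -!mulrA !(mulrBl, mul1r).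
by rewrite -!mulrA.
Qed.

(** By [TE], [T n * w] is the sum of a term killed by [e n.+1] and, for [w] in [W n], a term fixed
    by it. *)
Lemma proj_TE n w : W n w -> e n.+1 * (T n * w) = a * w - e n.+2 * (a * w).
Proof.
move=> Ww; rewrite TE mulrDr mulrBr proj_proj // subrr add0r mulrBr.
by rewrite proj_proj // Ww.
Qed.

Lemma T_pow n z : T n * (a ^+ n.+1 * z) = 0.
Proof.
rewrite TE f_W; last exact: W_pow.
by rewrite pow_proj // subrr add0r (W_pow n.+1 n.+1) // subrr.
Qed.

Lemma T_W n w : W n.+1 w -> T n * w = w - e n.+1 * w.
Proof. by move=> Ww; rewrite TE f_W // Ww subrr addr0. Qed.

Lemma d_idem n z : d n (d n z) = d n z.
Proof.
by rewrite [LHS]/d mul_d [e _ * (_ - _)]mulrBr proj_proj // subrr subr0.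
Qed.

Lemma T_d n w : W n w -> T n * d n.+1 w = a * w - e n.+2 * (a * w).
Proof.
move=> Ww; rewrite TE {1 2}/f d_idem subrr.
by rewrite mulr0 subrr add0r mul_d mulrBr proj_proj // subrr subr0.
Qed.

Lemma W_T n w : W n w -> W n.+1 (T n * w).
Proof.
move=> Ww; rewrite TE; apply: W_add.
  apply: W_add; first exact: W_f.
  by apply: W_opp; rewrite /e -mulrA; apply: W_pow.
rewrite -Ww; apply: W_add; first by rewrite /e -mulrA; apply: W_pow.
by apply: W_opp; rewrite /e -mulrA; apply: W_pow.
Qed.

(** * Complements of [a^{n+1}R] in [W n] *)

(** By induction: left multiplication by [T n] is injective on [pR], so replacing [p] by [T n * p]
    keeps the right annihilator [aR]. *)
Lemma complement_generator n :
  exists p : R, [/\ forall r, p * r = 0 <-> exists s, r = a * s,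
    forall r, W n (p * r),
    forall r s, p * r = a ^+ n.+1 * s -> p * r = 0
    & forall w, W n w -> exists r s, w = p * r + a ^+ n.+1 * s].
Proof.
elim: n => [|n [p [p0 Wp pI pS]]].
  (* [W 0] is all of [R], so a complement of [aR] is wanted. *)
  exists (1 - e 1); split.
  - move=> r; rewrite mulrBl mul1r; split=> [/subr0_eq ->|[s ->]].
      by exists (y 1 * r); rewrite mul_inner1.
    by rewrite proj1_mul subrr.
  - by move=> r; rewrite /W proj1_mul.
  - move=> r s; rewrite mulrBl mul1r => eqr.
    by rewrite eqr -(pow_proj 1) // -eqr mulrBr proj_proj // subrr.
  - move=> w _; exists w, (y 1 * w).
    by rewrite mulrBl mul1r mulrA subrK.
exists (T n * p); split.
- move=> r; rewrite -mulrA; split=> [Tpr0|/p0 ->]; last by rewrite mulr0.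
  (* Applying [e n.+1] puts [p * r] in [W n.+1], where [T n] acts as [1 - e n.+1]; so [p * r] lies
     in [a^{n+1}R] and vanishes by [pI]. *)
  apply/p0; have aE : W n.+1 (p * r).
    by apply/esym/subr0_eq; rewrite -proj_TE // Tpr0 mulr0.
  move: Tpr0; rewrite T_W // => /subr0_eq eqp.
  by apply: (pI r (y n.+1 * (p * r))); rewrite mulrA.
- by move=> r; rewrite -mulrA; apply: W_T.
- move=> r s; rewrite -mulrA => eqs; rewrite eqs.
  (* The element is fixed by both projections, but [e n.+1] sends it to a value killed by
     [e n.+2]. *)
  rewrite -(pow_proj n.+2) // -(pow_proj n.+1 n.+2) // -eqs proj_TE //.
  by rewrite mulrBr proj_proj // subrr.
(* [T n] sends [w] to [w - e n.+1 * w]; as [a * v] is the lost term, adding [d n.+1 v] to [w]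
   restores it modulo [a^{n+2}R]. *)
- move=> w Ww; pose v := a ^+ n * (y n.+1 * w).
  have av : a * v = e n.+1 * w by rewrite mulrA -exprS mulrA.
  have Wv : W n v by apply: W_pow.
  have Wn u : W n.+1 u -> W n u.
    by rewrite /W => <-; rewrite proj_proj.
  have Wd : W n (d n.+1 v).
    by rewrite /W mul_d mulrBr Wv proj_proj.
  have [|r [s rs]] := pS (w + d n.+1 v); first by apply: W_add => //; apply: Wn.
  exists r, (y n.+2 * (a * v)); rewrite -mulrA [X in _ + X]mulrA.
  have -> : T n * (p * r) = T n * (w + d n.+1 v).
    by rewrite rs mulrDr T_pow addr0.
  by rewrite mulrDr T_W // T_d // addrA av -/(e _) subrK subrK.
Qed.

(** * The direct sum decompositions *)

Let X n : right_ideal R := principal (y 1 * (1 - e n.+1) * a).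
(** The image of [a^{n+1}R] under [a ^+ n * y n.+1], a section there of left multiplication by
    [a]. *)
Let Y n : right_ideal R := principal (a ^+ n * y n.+1 * a ^+ n.+1).

Lemma mem_X n (x : R) : (exists z, x = d n z) <-> x \in X n.
Proof.
have XE z : y 1 * (1 - e n.+1) * a * z = d n z.
  by rewrite /d -!mulrA !mulrBl !mul1r -!mulrA.
by split=> [[z ->]|/principalP[z ->]]; [apply/principalP|]; exists z.
Qed.

Lemma mem_Y n (x : R) :
  (exists z, x = a ^+ n * (y n.+1 * (a ^+ n.+1 * z))) <-> x \in Y n.
Proof.
by split=> [[z ->]|/principalP[z ->]]; [apply/principalP|];
  exists z; rewrite -!mulrA.
Qed.

Lemma mul_Y n z : a * (a ^+ n * (y n.+1 * (a ^+ n.+1 * z))) = a ^+ n.+1 * z.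
Proof. by rewrite (mulrA a) -exprS (mulrA (y _)) mulrA yP. Qed.

Lemma X_cap_W n (x : R) : x \in X n -> W n x -> x = 0.
Proof. by move=> /mem_X[z ->] /d_W; rewrite d_idem. Qed.

Lemma Y_cap_rann n (x : R) : x \in Y n -> a * x = 0 -> x = 0.
Proof. by move=> /mem_Y[z ->]; rewrite mul_Y => ->; rewrite !mulr0. Qed.

Lemma W_decomp n w :
  W n w -> exists u v : R, [/\ a * u = 0, v \in Y n & w = u + v].
Proof.
move=> Ww; pose v := a ^+ n * (y n.+1 * (a * w)).
exists (w - v), v; split; last by rewrite subrK.
  by rewrite mulrBr (mulrA a) -exprS (mulrA _ (y _)) Ww subrr.
by apply/mem_Y; exists (y n.+1 * (a * w)); rewrite (mulrA (a ^+ n.+1)) Ww.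
Qed.

Lemma rannP (x : R) : reflect (a * x = 0) (x \in rann a).
Proof. exact: eqP. Qed.

Lemma W_Y n (x : R) : x \in Y n -> W n x.
Proof. by move=> /mem_Y[z ->]; apply: W_pow. Qed.

Lemma rann_X_Y_dsum n : is_dsum3 predT (rann a) (X n) (Y n).
Proof.
split=> [u v w /rannP au0 vX wY uvw0|x].
  have {}uvw0 : (u : R) + (v : R) + (w : R) = 0 := uvw0.
  have v0 : v = 0.
    apply: (X_cap_W n) => //.
    have -> : (v : R) = - ((u : R) + (w : R)).
      by apply/eqP; rewrite -addr_eq0 addrCA addrA uvw0.
    by apply/W_opp/W_add; [apply: W_rann | apply: W_Y].
  have w0 : w = 0.
    apply: (Y_cap_rann n) => //.
    by rewrite -[LHS]add0r -{1}au0 -mulrDr -[u : R]addr0 -{1}v0 uvw0 mulr0.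
  by split=> //; move: uvw0; rewrite v0 w0 !addr0.
have [u [v [au0 vY uv]]] := W_decomp n _ (W_f n x).
apply/esym/asboolP; exists ((u : R) + d n x), v; split=> //.
  apply/asboolP; exists u, (d n x); split=> //; first exact/rannP.
  by apply/mem_X; exists x.
by rewrite -[LHS](subrK (d n x)) -/(f n x) uv addrAC.
Qed.

Lemma rann_pow_dsum n :
  is_dsum2 (sum2 (rann a) (principal (a ^+ n))) (rann a) (Y n).
Proof.
split=> [u v /rannP au0 vY uv0|x].
  have {}uv0 : (u : R) + (v : R) = 0 := uv0.
  have v0 : v = 0.
    apply: (Y_cap_rann n) => //.
    by rewrite -[LHS]add0r -{1}au0 -mulrDr uv0 mulr0.
  by split=> //; move: uv0; rewrite v0 addr0.
apply/asboolP/asboolP=> [[u [v [/rannP au0 /principalP[z vE] xE]]]|].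
  have [|u' [v' [au' v'Y uv']]] := W_decomp n ((u : R) + (v : R)).
    by apply: W_add; [apply: W_rann | rewrite vE; apply: W_pow].
  by exists u', v'; split=> //; [apply/rannP | rewrite xE].
move=> [u [v [uK /mem_Y[z vE] xE]]]; exists u, v; split=> //.
by rewrite vE; apply/principalP; eexists.
Qed.

(** Since [a] maps [Y n] onto [a^{n+1}R], the hypotheses split [W n] into [pR] and [aY], and [X n]
    complements [W n]. *)
Lemma complement_dsum n (p : R) :
    (forall r, W n (p * r)) ->
    (forall r s, p * r = a ^+ n.+1 * s -> p * r = 0) ->
    (forall w, W n w -> exists r s, w = p * r + a ^+ n.+1 * s) ->
  is_dsum3 predT (principal p) (X n) (lmul_image a (Y n)).
Proof.
move=> Wp pI pS.
split=> [u v w /principalP[r uE] vX /asboolP[y0 /mem_Y[z ->]]|x].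
  rewrite mul_Y => wE uvw0.
  have {}uvw0 : (u : R) + (v : R) + (w : R) = 0 := uvw0.
  have v0 : v = 0.
    apply: (X_cap_W n) => //.
    have -> : (v : R) = - ((u : R) + (w : R)).
      by apply/eqP; rewrite -addr_eq0 addrCA addrA uvw0.
    by apply/W_opp/W_add; [rewrite uE | rewrite wE; apply: W_pow].
  have u0 : u = 0.
    rewrite uE; apply: (pI r (- z)); rewrite mulrN -uE -wE.
    by apply/eqP; rewrite -addr_eq0 -[u : R]addr0 -{1}v0 uvw0.
  by split=> //; move: uvw0; rewrite v0 u0 !add0r.
have [r [s rs]] := pS _ (W_f n x).
apply/esym/asboolP; exists (p * r + d n x), (a ^+ n.+1 * s); split=> //.
- apply/asboolP; exists (p * r), (d n x); split=> //.
    by apply/principalP; exists r.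
  by apply/mem_X; exists x.
- apply/asboolP; exists (a ^+ n * (y n.+1 * (a ^+ n.+1 * s))).
    by apply/mem_Y; exists s.
  by rewrite mul_Y.
- by rewrite -[LHS](subrK (d n x)) -/(f n x) rs addrAC.
Qed.

Lemma regular_powers_decomposition n :
  exists (X Y : right_ideal R) (p : R),
    [/\ is_dsum3 predT (rann a) X Y,
        is_dsum3 predT (principal p) X (lmul_image a Y),
        {subset Y <= principal (a ^+ n)},
        is_dsum2 (sum2 (rann a) (principal (a ^+ n))) (rann a) Y
      & forall r, p * r = 0 <-> r \in principal a] /\
    (a ^+ n = 0 -> rann a =i principal p).
Proof.
have [p [p0 Wp pI pS]] := complement_generator n.
exists (X n), (Y n), p; split; first split.
- exact: rann_X_Y_dsum.
- exact: complement_dsum.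
- by move=> x /mem_Y[z ->]; apply/principalP; eexists.
- exact: rann_pow_dsum.
- by move=> r; rewrite p0; split=> /principalP.
(* Now [W n] reduces to [rann a], and [pR], complementing zero in it, is all of it. *)
move=> an0 x; have an10 : a ^+ n.+1 = 0 by rewrite exprS an0 mulr0.
apply/rannP/principalP => [ax0|[r ->]].
  have [r [s ->]] := pS _ (W_rann n x ax0); exists r.
  by rewrite an10 mul0r addr0.
by rewrite -(Wp r) /e an10 !mul0r.
Qed.
End PowersRegular.

(** * Unit-regularity *)

(** The unit is [x * a * x + p]: the first term maps [aR] onto [xaR] and kills [(1 - ax)R]; the
    second kills [aR] and maps [(1 - ax)R] onto the annihilator of [a], a complement of [xaR]. *)
Lemma unit_regular_of_rann_principal (R : pzRingType) (a p : R) :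
    vn_regular a -> (forall r : R, p * r = 0 <-> r \in principal a) ->
    rann a =i principal p ->
  unit_regular a.
Proof.
move=> [x axa] pa ap; have {}axa z : a * (x * (a * z)) = a * z.
  by rewrite {3}axa -!mulrA.
have ap0 z : a * (p * z) = 0.
  by apply/rannP; rewrite ap; apply/principalP; exists z.
have pa0 z : p * (a * z) = 0 by apply/pa/principalP; exists z.
pose u := x * a * x + p.
have uE z : u * z = x * (a * (x * z)) + p * z by rewrite mulrDl -!mulrA.
have u_inj z : u * z = 0 -> z = 0.
  rewrite uE => uz0.
  have xz0 : a * (x * z) = 0.
    by rewrite -axa -[LHS]addr0 -(ap0 z) -mulrDr uz0 mulr0.
  have /pa/principalP[s zE] : p * z = 0 by move: uz0; rewrite xz0 mulr0 add0r.
  by move: xz0; rewrite zE axa.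
have /principalP[r rE] : 1 - x * a \in principal p.
  by rewrite -ap; apply/rannP; rewrite mulrBr -[in a * 1]axa !mulr1 subrr.
(* [u] sends [a] to [x * a] and [(1 - ax)r] to [p * r], which add up to 1. *)
pose v := a + (r - a * (x * r)).
have uv : u * v = 1.
  rewrite uE [p * v]mulrDr mulrBr -[a in p * a]mulr1 !pa0 add0r subr0 -rE.
  rewrite /v mulrDr mulrBr mulrDr mulrBr !axa subrr addr0.
  by rewrite -[X in a * (x * X)]mulr1 axa mulr1 addrC subrK.
exists u.
  exists v; split=> //; apply/subr0_eq/u_inj.
  by rewrite mulrBr mulrA uv mul1r mulr1 subrr.
have := axa 1; have := pa0 1; rewrite !mulr1 => pa1 axa1.
by rewrite -mulrA uE pa1 addr0 axa axa1.
Qed.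

Theorem theorem4 (R : pzRingType) (a : R)
    (a_reg : forall n : nat, (0 < n)%N -> vn_regular (a ^+ n)) :
  forall n : nat, (0 < n)%N ->
  exists X Y E : right_ideal R,
    [/\ is_dsum3 predT (rann a) X Y,
        is_dsum3 predT E X (lmul_image a Y),
        {subset Y <= principal (a ^+ n)},
        is_dsum2 (sum2 (rann a) (principal (a ^+ n))) (rann a) Y
      & isomorphic (submod E) (quotmod (principal a))] /\
    (a ^+ n = 0 ->
      [/\ isomorphic (submod (rann a)) (submod E),
          isomorphic (submod E) (quotmod (principal a))
        & unit_regular a]).
Proof.
have yP n : exists x : R, a ^+ n * (x * a ^+ n) = a ^+ n.
  (* Exponent 0 lies outside [a_reg]; there 1 serves. *)
  case: n => [|n]; first by exists 1; rewrite expr0 !mulr1.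
  by have [x xE] := a_reg n.+1 isT; exists x; rewrite mulrA -xE.
have [y {}yP] := choice yP; move=> n _.
have [X [Y [p [[KXY EXaY Ya KY pa] Kp]]]] :=
  regular_powers_decomposition R a y yP n.
have pIso := isomorphic_principal_quotmod R p (principal a) pa.
exists X, Y, (principal p); split=> // /Kp {}Kp; split=> //.
  exact: isomorphic_submod_eqi.
apply: (unit_regular_of_rann_principal R a p) => //.
by rewrite -(expr1 a); apply: a_reg.
Qed.
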